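(* Let $p$ be an odd prime, $q\in\mathbb{C}_p$ with $q\neq 1$ and $|q-1|_p<p^{-1/(p-1)}$, $\lambda\in\mathbb{C}_p$ with $\lambda\ne 0$, and $x\in\mathbb{C}_p$ with $|x|_p\le 1$. For every integer $n\ge 0$, $$\int_{\mathbb{Z}_p}\left([x+y]_q\right)_{n,\lambda}\,d\mu_{-q}(y)=E_{n,q}(x|\lambda),$$ where $\left([x+y]_q\right)_{n,\lambda}=[x+y]_q\left([x+y]_q-\lambda\right)\cdots\left([x+y]_q-(n-1)\lambda\right)$.
   Context: $\mathbb{Z}_p$ is the ring of $p$-adic integers and $\mathbb{C}_p$ the completion of the algebraic closure of $\mathbb{Q}_p$, with $|p|_p=1/p$. For $|z|_p\le 1$, $q^z=\exp(z\log q)$ and $[z]_q=\frac{1-q^z}{1-q}$; also $[N]_{-q}=\frac{1-(-q)^N}{1+q}$ for integers $N\ge 0$. The fermionic $p$-adic $q$-integral of a continuous function $f:\mathbb{Z}_p\to\mathbb{C}_p$ is $$\int_{\mathbb{Z}_p}f(y)\,d\mu_{-q}(y)=\lim_{N\to\infty}\frac{1}{[p^N]_{-q}}\sum_{y=0}^{p^N-1}f(y)(-q)^y .$$ The degenerate $q$-Euler polynomials $E_{n,q}(x|\lambda)$ are defined by the generating function $$\int_{\mathbb{Z}_p}(1+\lambda t)^{\frac{1}{\lambda}[x+y]_q}\,d\mu_{-q}(y)=\sum_{n=0}^\infty E_{n,q}(x|\lambda)\frac{t^n}{n!},$$ where $(1+\lambda t)^{z/\lambda}=\exp\left(\frac{z}{\lambda}\log(1+\lambda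 t)\right)$ is expanded as a power series in $t$ and the integral is taken coefficientwise. The degenerate falling factorial is $(z)_{n,\lambda}=z(z-\lambda)(z-2\lambda)\cdots(z-(n-1)\lambda)$, with $(z)_{0,\lambda}=1$. *)

(* Defs.v *)
From HB Require Import structures.
From mathcomp Require Import all_boot all_order all_algebra.
From mathcomp Require Import all_classical all_reals all_analysis.
Set Implicit Arguments.
Unset Strict Implicit.
Unset Printing Implicit Defensive.
Import Order.TTheory GRing.Theory Num.Theory.
Local Open Scope classical_set_scope.
Local Open Scope ring_scope.

(* Fields with a non-archimedean absolute value.  MathComp's normed structures
   require `|x *+ n| = `|x| *+ n, which excludes p-adic absolute values. *)
HB.mixin Record isNonArchimedean (R : realType) K & GRing.Field K := {
  vabs : K -> R ;
  vabs_ge0 : forall x, 0 <= vabs x ;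
  vabs_eq0 : forall x, vabs x = 0 <-> x = 0 ;
  vabsM : forall x y, vabs (x * y) = vabs x * vabs y ;
  vabsD_max : forall x y, vabs (x + y) <= Num.max (vabs x) (vabs y)
}.

#[short(type="nonArchFieldType")]
HB.structure Definition NonArchField (R : realType) :=
  {K of GRing.Field K & isNonArchimedean R K}.

Section NonArchMetric.
Context {R : realType} {K : nonArchFieldType R}.
Implicit Types x y z : K.

Definition vdist x y : R := vabs (x - y).

Lemma vabs1 : vabs (1 : K) = 1.
Proof.
have n0 : vabs (1 : K) != 0.
  by apply/eqP => /vabs_eq0/eqP; rewrite oner_eq0.
by apply: (mulfI n0); rewrite -vabsM !mulr1.
Qed.

Lemma vabs0 : vabs (0 : K) = 0.
Proof. exact/vabs_eq0. Qed.

Lemma vabsN x : vabs (- x) = vabs x.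
Proof.
suff e : vabs (-1 : K) = 1 by rewrite -mulN1r vabsM e mul1r.
have : vabs (-1 : K) ^+ 2 = 1 by rewrite expr2 -vabsM mulrNN mulr1 vabs1.
move/eqP; rewrite sqrf_eq1 => /orP[/eqP//|/eqP e].
by have := vabs_ge0 (-1 : K); rewrite e oppr_ge0 ler10.
Qed.

Lemma vdistxx x : vdist x x = 0.
Proof. by rewrite /vdist subrr vabs0. Qed.

Lemma vdist_positivity x y : vdist x y = 0 -> x = y.
Proof. by move/vabs_eq0/eqP; rewrite subr_eq0 => /eqP. Qed.

Lemma vdist_sym x y : vdist x y = vdist y x.
Proof. by rewrite /vdist -opprB vabsN. Qed.

Lemma vdist_triangle y x z : vdist x z <= vdist x y + vdist y z.
Proof.
rewrite /vdist -(subrKA y) (le_trans (vabsD_max _ _))// ge_max.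
by rewrite lerDl lerDr !vabs_ge0.
Qed.

End NonArchMetric.

HB.instance Definition _ (R : realType) (K : nonArchFieldType R) :=
  isPointed.Build K 0.

HB.instance Definition _ (R : realType) (K : nonArchFieldType R) :=
  isMetric.Build R K vdistxx vdist_positivity vdist_sym vdist_triangle.

Section Cp.
Context {R : realType}.
Implicit Type K : nonArchFieldType R.

Definition Qp K : set K := closure (range (ratr : rat -> K)).

Definition Zp K : set K := [set x | Qp x /\ vabs x <= 1].

Definition Qp_algebraic K : set K :=
  [set z | exists P : {poly K}, [/\ P != 0, forall i, Qp P`_i & root P z]].

(* K is a completion of an algebraic closure of Q_p: inside the complete field
   K, Qp is the completion of Q for the p-adic absolute value (the one with
   |p| = 1/p), Qp_algebraic is an algebraically closed algebraic extension of
   Qp, and it is dense in K.  This determines K up to isometric isomorphism. *)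
Record is_Cp (p : nat) K : Prop := {
  Cp_complete : forall F : set_system K, ProperFilter F -> cauchy F -> cvg F ;
  Cp_vabs_p : vabs (p%:R : K) = (p%:R)^-1 ;
  Cp_Qp_algebraic_closed : forall P : {poly K},
    (forall i, Qp_algebraic P`_i) -> (1 < size P)%N ->
    exists2 z, Qp_algebraic z & root P z ;
  Cp_Qp_algebraic_dense : dense (@Qp_algebraic K)
}.

End Cp.

Section FermionicIntegral.
Context {R : realType} {K : nonArchFieldType R}.
Implicit Types (q x y z lam : K) (f : K -> K) (n N k : nat).

Definition padic_exp z : K := limn (series (fun k => z ^+ k / k`!%:R)).

Definition padic_log z : K :=
  limn (series (fun k => (-1) ^+ k * (z - 1) ^+ k.+1 / k.+1%:R)).

Definition qpow q z : K := padic_exp (z * padic_log q).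

Definition qnum q z : K := (1 - qpow q z) / (1 - q).

Definition qnum_neg q N : K := (1 - (- q) ^+ N) / (1 + q).

(* A function on Z_p is represented by a function on K of which only the
   restriction to Zp matters. *)
Definition fermionic_sum (p : nat) q f N : K :=
  (qnum_neg q (p ^ N))^-1 * \sum_(0 <= y < p ^ N) f y%:R * (- q) ^+ y.

Definition fermionic_integrable (p : nat) q f : Prop :=
  {within @Zp R K, continuous f} /\ cvgn (fermionic_sum p q f).

Definition fermionic_integral (p : nat) q f : K := limn (fermionic_sum p q f).

(* Formal power series in t over K, as coefficient sequences. *)
Implicit Types F G : nat -> K.

Definition fps_mul F G n : K := \sum_(i < n.+1) F i * G (n - i)%N.

Definition fps_pow F k : nat -> K := iter k (fps_mul F) (fun n => (n == 0)%:R).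

(* exp(F(t)) for F(0) = 0: then F^k has no term of degree < k, so the terms
   k > n do not contribute to the coefficient of t^n. *)
Definition fps_exp F n : K := \sum_(k < n.+1) fps_pow F k n / k`!%:R.

(* log(1 + lam t) *)
Definition fps_log1p lam n : K :=
  if n is m.+1 then (-1) ^+ m * lam ^+ n / n%:R else 0.

(* (1 + lam t)^(z / lam) *)
Definition degenerate_fps_exp lam z : nat -> K :=
  fps_exp (fun n => z / lam * fps_log1p lam n).

(* The generating series of the E_n / n!. *)
Definition degenerate_qEuler_series (p : nat) q x lam n : K :=
  fermionic_integral p q (fun y => degenerate_fps_exp lam (qnum q (x + y)) n).

Definition degenerate_qEuler (p : nat) q x lam n : K :=
  n`!%:R * degenerate_qEuler_series p q x lam n.

Definition degenerate_ffact lam z n : K := \prod_(i < n) (z - i%:R * lam).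

End FermionicIntegral.

(* Main.v *)
(* Writing L = log q, e = exp(x L) and r = exp L, one has q^(x+y) = e exp(y L),
   so a polynomial in [x+y]_q is a polynomial in exp(y L), which is r^y when y
   is a natural number.  Its fermionic sums are therefore combinations of the sums
     sum_(y < p^N) (- r^k q)^y = (1 + (r^k q)^(p^N)) / (1 + r^k q),
   and these converge because a^(p^N) tends to 1 when |a - 1| < 1 while
   |1 + a| = |2| = 1, p being odd.  The convergence of exp and log rests on
   |n!| >= rho^(n-1), where rho = p^(-1/(p-1)) (Legendre's formula).
   The two integrands agree up to n!: the coefficients E_n of
   (1 + lam t)^(z/lam) satisfy (n+1) E_(n+1) = (z - n lam) E_n, from
   (1 + lam t) E' = z E. *)
Require Import Defs.
From HB Require Import structures.
From mathcomp Require Import all_boot all_order all_algebra.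
From mathcomp Require Import all_classical all_reals all_analysis.
From mathcomp Require Import ring lra zify.
Set Implicit Arguments.
Unset Strict Implicit.
Unset Printing Implicit Defensive.
Import Order.TTheory GRing.Theory Num.Theory.
Local Open Scope classical_set_scope.
Local Open Scope ring_scope.

(** * Consequences of the ultrametric inequality *)

Section AbsoluteValue.
Context {R : realType} {K : nonArchFieldType R}.
Implicit Types x y z : K.

Lemma vabsX x n : vabs (x ^+ n) = vabs x ^+ n.
Proof.
elim: n => [|n ih]; first by rewrite !expr0 vabs1.
by rewrite !exprS vabsM ih.
Qed.

Lemma vabsV x : vabs x^-1 = (vabs x)^-1.
Proof.
have [->|x0] := eqVneq x 0; first by rewrite invr0 vabs0 invr0.
have vx0 : vabs x != 0 by apply: contraNneq x0 => /vabs_eq0/eqP.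
by apply: (mulfI vx0); rewrite -vabsM !mulfV// vabs1.
Qed.

Lemma vabsD_le x y b : vabs x <= b -> vabs y <= b -> vabs (x + y) <= b.
Proof. by move=> xb yb; rewrite (le_trans (vabsD_max _ _))// ge_max xb. Qed.

Lemma vabsM_le x y a b : vabs x <= a -> vabs y <= b -> vabs (x * y) <= a * b.
Proof. by move=> xa yb; rewrite vabsM ler_pM// vabs_ge0. Qed.

Lemma vabsBC x y : vabs (x - y) = vabs (y - x).
Proof. exact: vdist_sym. Qed.

Lemma vabs_sum_le (I : Type) (r : seq I) (P : pred I) (F : I -> K) (b : R) :
  0 <= b -> (forall i, P i -> vabs (F i) <= b) ->
  vabs (\sum_(i <- r | P i) F i) <= b.
Proof.
move=> b0 Fb; elim/big_ind : _ => //; first by rewrite vabs0.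
by move=> x y; exact: vabsD_le.
Qed.

Lemma vabs_nat_le1 n : vabs (n%:R : K) <= 1.
Proof.
elim: n => [|n ih]; first by rewrite vabs0.
by rewrite -natr1 vabsD_le// vabs1.
Qed.

Lemma vabs_near1 x y : vabs x = 1 -> vabs (y - x) < 1 -> vabs y = 1.
Proof.
move=> x1 xy; apply/eqP; rewrite eq_le; apply/andP; split.
  by rewrite -(subrK x y) vabsD_le ?x1// ltW.
rewrite leNgt; apply/negP => y1.
suff : vabs x < 1 by rewrite x1 ltxx.
rewrite -(subKr y x) (le_lt_trans (vabsD_max _ _))// gt_max y1 vabsN.
exact: xy.
Qed.

Lemma vabs_near1_le x y : vabs x = 1 -> vabs (y - x) < 1 -> vabs y <= 1.
Proof. by move=> x1 /(vabs_near1 x1) ->. Qed.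

(** The cofactor of x - y in x^n - y^n is a sum of products of elements of the unit ball, hence lies
    in it. *)
Lemma vabsBX_le x y n : vabs x <= 1 -> vabs y <= 1 ->
  vabs (x ^+ n - y ^+ n) <= vabs (x - y).
Proof.
move=> x1 y1; rewrite subrXX vabsM ler_piMr ?vabs_ge0// vabs_sum_le// => i _.
by rewrite vabsM !vabsX mulr_ile1 ?exprn_ge0 ?exprn_ile1 ?vabs_ge0.
Qed.

End AbsoluteValue.

(** * Legendre's bound and p-adic absolute values of integers *)

Lemma logn_fact_leq p n : prime p -> (logn p n.+1`! * p.-1 <= n)%N.
Proof.
move=> pp; rewrite logn_fact//.
(* Induction on the number N of terms, with m general. Put d = m %/ p: the first term is d and the
   others form the sum for d, so for d > 0 the total times p - 1 is at most d (p - 1) + (d - 1) = d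
   p - 1 <= m - 1. *)
suff : forall N m,
    (0 < m -> (\sum_(1 <= k < N.+1) m %/ p ^ k) * p.-1 <= m.-1)%N.
  by move=> /(_ n.+1 n.+1 isT).
elim=> [|N ih] m m0; first by rewrite big_geq.
rewrite big_add1 /= big_nat_recl// expn1.
under eq_bigr do rewrite expnS divnMA.
have := ih (m %/ p)%N; rewrite big_add1 /=.
have p1 := prime_gt1 pp; have := leq_divM m p.
have [->|d0] := posnP (m %/ p)%N.
  move=> _ _; rewrite big1 ?muln0// => i _; exact: div0n.
move=> d /(_ isT); rewrite mulnDl; nia.
Qed.

Section PadicAbsoluteValue.
Context {R : realType} {K : nonArchFieldType R} (p : nat).
Hypotheses (pp : prime p) (vp : vabs (p%:R : K) = p%:R^-1).

Lemma vabs_p_lt1 : vabs (p%:R : K) < 1.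
Proof. by rewrite vp invf_lt1 ?ltr0n ?ltr1n ?prime_gt0 ?prime_gt1. Qed.

Lemma vabs_nat_coprime n : coprime p n -> vabs (n%:R : K) = 1.
Proof.
move=> cpn; apply/eqP; rewrite eq_le vabs_nat_le1 leNgt; apply/negP => n1.
(* Bezout gives 1 = d p - u n, where both terms would have absolute value below 1. *)
have [u _ /dvdnP[d]] := Bezoutr n (prime_gt0 pp).
rewrite gcdnC (eqP cpn) => /(congr1 (fun m => m%:R : K)).
rewrite natrD !natrM => /(canRL (addrK _)) e.
have : vabs (1 : K) < 1; last by rewrite vabs1 ltxx.
rewrite [X in vabs X]e (le_lt_trans (vabsD_max _ _))// vabsN !vabsM gt_max.
rewrite !(le_lt_trans (ler_piMl (vabs_ge0 _) (vabs_nat_le1 _)))//.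
exact: vabs_p_lt1.
Qed.

Lemma vabs_nat n : (0 < n)%N -> vabs (n%:R : K) = p%:R^-1 ^+ logn p n.
Proof.
move=> n0; have [m cpm e] := pfactor_coprime pp n0.
by rewrite {1}e natrM natrX vabsM vabs_nat_coprime// mul1r vabsX vp.
Qed.

Lemma natf_neq0_padic n : (0 < n)%N -> (n%:R : K) != 0.
Proof.
move=> n0; apply/eqP => /vabs_eq0/eqP; rewrite vabs_nat//.
by rewrite expf_eq0 invr_eq0 pnatr_eq0 (gtn_eqF (prime_gt0 pp)) andbF.
Qed.

Let rho : R := p%:R `^ (- (p.-1%:R)^-1).

Lemma padic_radius_gt0 : 0 < rho.
Proof. by rewrite powR_gt0// ltr0n prime_gt0. Qed.

Lemma padic_radius_exp : rho ^+ p.-1 = p%:R^-1.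
Proof.
have p1 := prime_gt1 pp.
rewrite -powR_mulrn ?ltW ?padic_radius_gt0// -powRrM mulNr mulVf.
  by rewrite powR_inv1.
by rewrite pnatr_eq0; lia.
Qed.

Lemma padic_radius_le1 : rho <= 1.
Proof.
have p1 := prime_gt1 pp.
rewrite -(@expr_le1 _ p.-1) ?padic_radius_exp ?ltW ?padic_radius_gt0//;
  last lia.
by rewrite -vp vabs_p_lt1.
Qed.

(** Written in powers of [rho], this is [logn_fact_leq], since 1/p = [rho]^(p - 1). *)
Lemma vabs_fact_ge n : rho ^+ n <= vabs (n.+1`!%:R : K).
Proof.
rewrite vabs_nat ?fact_gt0// -padic_radius_exp -exprM.
have r0 := padic_radius_gt0; have r1 := padic_radius_le1.
by rewrite ler_wiXn2l ?(ltW r0)// mulnC logn_fact_leq.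
Qed.

(** n + 1 divides (n + 1)!, so it is at least as large. The bound is crude, but it puts the
    logarithm under the same estimates as the exponential. *)
Lemma vabs_nat_ge n : rho ^+ n <= vabs (n.+1%:R : K).
Proof.
rewrite (le_trans (vabs_fact_ge n))// factS natrM vabsM.
by rewrite ler_piMr ?vabs_ge0 ?vabs_nat_le1.
Qed.

(** The factor [vabs z] stays outside the power because it is what yields |exp z - 1| <= |z|. *)
Lemma vabs_exp_term z n :
  vabs (z ^+ n.+1 / n.+1`!%:R : K) <= vabs z * (vabs z / rho) ^+ n.
Proof.
have r0 := padic_radius_gt0.
rewrite vabsM vabsX vabsV exprS -mulrA ler_wpM2l ?vabs_ge0// expr_div_n.
rewrite ler_wpM2l ?exprn_ge0 ?vabs_ge0// lef_pV2 ?vabs_fact_ge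
  ?posrE ?exprn_gt0//.
by rewrite (lt_le_trans _ (vabs_fact_ge n))// exprn_gt0.
Qed.

Lemma vabs_log_term z n :
  vabs ((-1) ^+ n * z ^+ n.+1 / n.+1%:R : K) <= vabs z * (vabs z / rho) ^+ n.
Proof.
have r0 := padic_radius_gt0.
rewrite 2!vabsM !vabsX vabsV vabsN vabs1 expr1n mul1r exprS -mulrA.
rewrite ler_wpM2l ?vabs_ge0// expr_div_n ler_wpM2l ?exprn_ge0 ?vabs_ge0//.
rewrite lef_pV2 ?vabs_nat_ge ?posrE ?exprn_gt0//.
by rewrite (lt_le_trans _ (vabs_nat_ge n))// exprn_gt0.
Qed.

End PadicAbsoluteValue.

(** * Limits in a non-archimedean field *)

Section Limits.
Import numFieldNormedType.Exports.
Context {R : realType} {K : nonArchFieldType R}.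
Implicit Types (u v : nat -> K) (a b l : K).

Lemma vabs_ballE a e b : ball a e b = (vabs (a - b) < e) :> Prop.
Proof. by []. Qed.

Lemma cvg_vabsP u l :
  u @ \oo --> l <-> (fun n => vabs (u n - l)) @ \oo --> (0 : R).
Proof.
split=> [/cvg_ballP ul|/cvgrPdist_lt ul].
  apply/cvgrPdist_lt => e e0; near=> n.
  rewrite sub0r normrN ger0_norm ?vabs_ge0// vabsBC -vabs_ballE.
  by near: n; exact: ul.
apply/cvg_ballP => e e0; near=> n; rewrite vabs_ballE vabsBC.
rewrite -[ltLHS]ger0_norm ?vabs_ge0// -normrN -sub0r.
by near: n; exact: ul.
Unshelve. all: by end_near. Qed.

Lemma cvg_vabs_le u l (e : nat -> R) :
  (forall n, vabs (u n - l) <= e n) -> e @ \oo --> (0 : R) -> u @ \oo --> l.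
Proof.
move=> ule e0; apply/cvg_vabsP.
apply: (@squeeze_cvgr _ _ _ _ (fun=> 0) e) => //; last exact: cvg_cst.
by near=> n; rewrite vabs_ge0 ule.
Unshelve. all: by end_near. Qed.

Lemma cvg_vabs_lim u l : u @ \oo --> l -> limn u = l.
Proof. by apply: cvg_lim; exact: metric_hausdorff. Qed.

Lemma cvg_vabs_eq u a b : u @ \oo --> a -> u @ \oo --> b -> a = b.
Proof. by move=> /cvg_vabs_lim <- /cvg_vabs_lim. Qed.

Lemma cvg_vabsD u v a b :
  u @ \oo --> a -> v @ \oo --> b -> (fun n => u n + v n) @ \oo --> a + b.
Proof.
move=> /cvg_vabsP ua /cvg_vabsP vb.
apply: (@cvg_vabs_le _ _ (fun n => vabs (u n - a) + vabs (v n - b))) => [n|].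
  rewrite opprD addrACA (le_trans (vabsD_max _ _))//.
  by rewrite ge_max lerDl lerDr !vabs_ge0.
by rewrite -(addr0 0); exact: cvgD.
Qed.

Lemma cvg_vabsMl u a c : u @ \oo --> a -> (fun n => c * u n) @ \oo --> c * a.
Proof.
move=> /cvg_vabsP ua.
apply: (@cvg_vabs_le _ _ (fun n => vabs c * vabs (u n - a))) => [n|].
  by rewrite -mulrBr vabsM.
by rewrite -(mulr0 (vabs c)); exact: cvgMl_tmp.
Qed.

Lemma cvg_vabsM u v a b :
  u @ \oo --> a -> v @ \oo --> b -> (fun n => u n * v n) @ \oo --> a * b.
Proof.
move=> ua vb.
have uv0 : (fun n => (u n - a) * (v n - b)) @ \oo --> (0 : K).
  move: ua vb => /cvg_vabsP ua /cvg_vabsP vb.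
  apply: (@cvg_vabs_le _ _ (fun n => vabs (u n - a) * vabs (v n - b))) => [n|].
    by rewrite subr0 vabsM.
  by rewrite -(mulr0 0); exact: cvgM.
(* Both factors of the first product tend to 0; the rest is affine in u and v. *)
have e : (fun n => u n * v n) =
    (fun n => (u n - a) * (v n - b) + ((b * u n + a * v n) + - (a * b))).
  by apply/funext => n; ring.
have -> : a * b = 0 + ((b * a + a * b) + - (a * b)) by ring.
rewrite e; apply: cvg_vabsD => //; apply: cvg_vabsD; last exact: cvg_cst.
by apply: cvg_vabsD; exact: cvg_vabsMl.
Qed.

Lemma cvg_vabs_sum (n : nat) (u : 'I_n -> nat -> K) (l : 'I_n -> K) :
  (forall i, u i @ \oo --> l i) ->
  (fun N => \sum_(i < n) u i N) @ \oo --> \sum_(i < n) l i.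
Proof.
elim: n u l => [|n ih] u l ul.
  rewrite big_ord0; under eq_fun do rewrite big_ord0; exact: cvg_cst.
rewrite big_ord_recr/=; under eq_fun do rewrite big_ord_recr/=.
exact: cvg_vabsD (ih _ _ (fun i => ul _)) (ul _).
Qed.

(** The constant absolute value turns |1/u - 1/a| = |u - a| / |u a| into |u - a| / |a|^2. *)
Lemma cvg_vabsV u a : a != 0 ->
  (forall n, vabs (u n) = vabs a) -> u @ \oo --> a ->
  (fun n => (u n)^-1) @ \oo --> a^-1.
Proof.
move=> a0 ua /cvg_vabsP cu.
have va0 : vabs a != 0 by apply: contra_neq a0 => /vabs_eq0.
apply: (@cvg_vabs_le _ _ (fun n => vabs (u n - a) * (vabs a ^- 2))) => [n|];
  last first.
  by rewrite -(mul0r (vabs a ^- 2)); exact: cvgMr_tmp.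
have un0 : u n != 0.
  by apply: contra_neq va0 => e; rewrite -(ua n) e vabs0.
have -> : (u n)^-1 - a^-1 = (a - u n) / (u n * a) by field; rewrite a0 un0.
by rewrite vabsM vabsV vabsM ua -expr2 vabsBC.
Qed.

Lemma vabs_cvg_le u l (b : R) :
  u @ \oo --> l -> (forall n, vabs (u n) <= b) -> vabs l <= b.
Proof.
move=> /cvg_vabsP ul ub; rewrite leNgt; apply/negP => bl.
have b0 : 0 <= b by rewrite (le_trans (vabs_ge0 (u 0%N))).
have l0 : 0 < vabs l by exact: le_lt_trans bl.
move/cvgrPdist_lt : ul => /(_ _ l0)[N _ /(_ N (leqnn N))].
rewrite /= sub0r normrN ger0_norm ?vabs_ge0// => uNl.
have : vabs l < vabs l; last by rewrite ltxx.
rewrite -[X in vabs X < _](subKr (u N)) (le_lt_trans (vabsD_max _ _))//.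
by rewrite gt_max vabsN uNl (le_lt_trans (ub N)).
Qed.

End Limits.

(** * Series dominated by a geometric one *)

Section Series.
Context {R : realType} {K : nonArchFieldType R}.
Import numFieldNormedType.Exports.
Implicit Types u v : nat -> K.

Lemma cvg_geometric_seq (c th : R) : 0 <= th < 1 ->
  (fun n => c * th ^+ n) @ \oo --> (0 : R).
Proof.
by move=> /andP[th0 th1]; apply: cvg_geometric; rewrite ger0_norm.
Qed.

Lemma vabs_series_le u (b : R) n :
  0 <= b -> (forall k, vabs (u k) <= b) -> vabs (series u n) <= b.
Proof. by move=> b0 ub; exact: vabs_sum_le. Qed.

(** An ultrametric sum is bounded by its largest term, and the bound on the first term of the tail
    covers all the others. *)
Lemma vabs_series_tail_le u (th : R) m n : 0 <= th <= 1 -> (m <= n)%N ->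
  (forall k, vabs (u k) <= th ^+ k) ->
  vabs (series u n - series u m) <= th ^+ m.
Proof.
move=> /andP[th0 th1] mn uth; rewrite sub_series_geq// big_nat.
rewrite vabs_sum_le ?exprn_ge0// => i /andP[mi _].
by rewrite (le_trans (uth i))// ler_wiXn2l.
Qed.

Lemma is_cvg_series_geometric u (th : R) :
  (forall F : set_system K, ProperFilter F -> cauchy F -> cvg F) ->
  0 <= th < 1 -> (forall k, vabs (u k) <= th ^+ k) -> cvgn (series u).
Proof.
move=> cK th01 uth; have th01' : 0 <= th <= 1 by lra.
apply: cK; apply: cauchy_exP => e e0.
have /cvgrPdist_lt/(_ _ e0)[N _ thN] := cvg_geometric_seq 1 th01.
exists (series u N); exists N => // n /= Nn.
rewrite vabs_ballE vabsBC (le_lt_trans (vabs_series_tail_le th01' Nn uth))//.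
have := thN N (leqnn N); rewrite /= sub0r normrN mul1r; apply: le_lt_trans.
exact: ler_norm.
Qed.

Lemma cvg_series_cauchy_product u v (th : R) (a b : K) : 0 <= th < 1 ->
  (forall k, vabs (u k) <= th ^+ k) -> (forall k, vabs (v k) <= th ^+ k) ->
  series u @ \oo --> a -> series v @ \oo --> b ->
  series (fun n => \sum_(i < n.+1) u i * v (n - i)%N) @ \oo --> a * b.
Proof.
move=> th01 uth vth ua vb; have th01' : 0 <= th <= 1 by lra.
set w := (X in series X).
(* Regrouped by rows: u_i meets the v_j with i + j < n. *)
have wE n : series w n = \sum_(i < n) u i * series v (n - i)%N.
  elim: n => [|n ih]; first by rewrite /series/= big_geq// big_ord0.
  rewrite {1}/series /= big_nat_recr//= -[\sum_(0 <= _ < n) _]/(series w n) ih.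
  rewrite [RHS]big_ord_recr/= subSnn [w n]big_ord_recr/= subnn addrA.
  congr (_ + _ * _); last by rewrite /series /= big_nat1.
  rewrite -big_split/=; apply: eq_bigr => i _; rewrite -mulrDr; congr (_ * _).
  by rewrite subSn ?(ltnW (ltn_ord i))// /series /= big_nat_recr.
(* The difference is the sum of the u_i times the tail of v from n - i to n, each at most th^i th^(n
   - i) = th^n. The sign is such that adding the product of partial sums leaves [series w]. *)
have uv0 : (fun n => - (series u n * series v n - series w n)) @ \oo -->
    (0 : K).
  apply: (cvg_vabs_le _ (cvg_geometric_seq 1 th01)) => n.
  rewrite subr0 vabsN mul1r wE {1}/series/= big_mkord mulr_suml -sumrB.
  rewrite vabs_sum_le ?exprn_ge0//; first by case/andP: th01.
  move=> i _; rewrite -mulrBr.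
  have -> : th ^+ n = th ^+ i * th ^+ (n - i).
    by rewrite -exprD subnKC// ltnW.
  by rewrite vabsM_le// vabs_series_tail_le// leq_subr.
have := cvg_vabsD uv0 (cvg_vabsM ua vb); rewrite add0r.
by under eq_fun do rewrite opprB subrK.
Qed.

End Series.

(** * The p-adic exponential and logarithm *)

Section Exponential.
Context {R : realType} {K : nonArchFieldType R} (p : nat).
Hypotheses (pp : prime p) (vp : vabs (p%:R : K) = p%:R^-1).
Hypothesis cK : forall F : set_system K, ProperFilter F -> cauchy F -> cvg F.
Implicit Types x y z : K.

Let rho : R := p%:R `^ (- (p.-1%:R)^-1).
Let rho_gt0 : 0 < rho := padic_radius_gt0 pp.
Let rho_le1 : rho <= 1 := padic_radius_le1 pp vp.

(** A common bound s gives two arguments one ratio, as the Cauchy product needs; the isolated factor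
    |z| is at most s / [rho] because [rho] <= 1. *)
Lemma vabs_exp_term_geometric z n (s : R) : vabs z <= s ->
  vabs (z ^+ n / n`!%:R) <= (s / rho) ^+ n.
Proof.
move=> zs; have s0 : 0 <= s by rewrite (le_trans _ zs) ?vabs_ge0.
case: n => [|n]; first by rewrite !expr0 fact0 divr1 vabs1.
rewrite (le_trans (vabs_exp_term pp vp z n))// exprS ler_pM//.
- exact: vabs_ge0.
- by rewrite exprn_ge0// divr_ge0 ?vabs_ge0// ltW.
- by rewrite (le_trans zs)// ler_peMr// invf_ge1.
- apply: lerXn2r; rewrite ?nnegrE ?divr_ge0 ?vabs_ge0 ?(ltW rho_gt0)//.
  by rewrite ler_pM2r// invr_gt0.
Qed.

Lemma cvg_padic_exp z : vabs z < rho ->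
  series (fun k => z ^+ k / k`!%:R) @ \oo --> padic_exp z.
Proof.
move=> zr; apply: (@is_cvg_series_geometric _ _ _ (vabs z / rho)) => //.
  by rewrite divr_ge0 ?vabs_ge0 ?ltW//= ltr_pdivrMr// mul1r.
by move=> k; exact: vabs_exp_term_geometric.
Qed.

Lemma padic_expD x y : vabs x < rho -> vabs y < rho ->
  padic_exp (x + y) = padic_exp x * padic_exp y.
Proof.
move=> xr yr; set s := Num.max (vabs x) (vabs y).
have sr : s < rho by rewrite gt_max xr.
have s0 : 0 <= s by rewrite le_max vabs_ge0.
have th : 0 <= s / rho < 1.
  by rewrite divr_ge0 ?(ltW rho_gt0)//= ltr_pdivrMr// mul1r.
have xyr : vabs (x + y) < rho by rewrite (le_lt_trans (vabsD_max _ _)).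
apply: cvg_vabs_eq (cvg_padic_exp xyr) _.
have -> : (fun k => (x + y) ^+ k / k`!%:R) = (fun n =>
    \sum_(i < n.+1) x ^+ i / i`!%:R * (y ^+ (n - i) / (n - i)`!%:R)); last first.
  apply: cvg_series_cauchy_product th _ _ (cvg_padic_exp xr) (cvg_padic_exp yr).
    by move=> k; apply: vabs_exp_term_geometric; rewrite le_max lexx.
  by move=> k; apply: vabs_exp_term_geometric; rewrite le_max lexx orbT.
apply/funext => n.
(* Binomial theorem, with C(n, i) / n! = 1 / (i! (n - i)!); [exprDn] puts the exponent n - i on the
   first summand, hence [addrC]. *)
rewrite addrC exprDn mulr_suml; apply: eq_bigr => i _.
have n0 k : (k`!%:R : K) != 0 by rewrite (natf_neq0_padic pp vp)// fact_gt0.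
rewrite -(bin_fact (ltn_ord i : (i <= n)%N)) !natrM -mulr_natr.
have := n0 i; have := n0 (n - i)%N.
have : ('C(n, i)%:R : K) != 0.
  by rewrite (natf_neq0_padic pp vp)// bin_gt0 -ltnS.
by move=> h1 h2 h3; field; rewrite h1 h2 h3.
Qed.

Lemma vabs_exp_sub1 z : vabs z < rho -> vabs (padic_exp z - 1) <= vabs z.
Proof.
(* Shifted by one, every partial sum contains the term 1, which is split off and cancelled. *)
move=> zr; have := cvg_padic_exp zr; rewrite -cvg_shiftS => ez.
have m1 : (fun=> -1) @ \oo --> (-1 : K) by exact: cvg_cst.
apply: (vabs_cvg_le (cvg_vabsD ez m1)) => n.
rewrite /series/= big_nat_recl// expr0 fact0 divr1 addrC addKr.
rewrite vabs_sum_le ?vabs_ge0// => i _.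
rewrite (le_trans (vabs_exp_term pp vp _ _))// ler_piMr ?vabs_ge0//.
rewrite exprn_ile1 ?divr_ge0 ?vabs_ge0 ?(ltW rho_gt0)//.
by rewrite ler_pdivrMr// mul1r ltW.
Qed.

Lemma vabs_exp z : vabs z < rho -> vabs (padic_exp z) = 1.
Proof.
move=> zr; apply: (vabs_near1 vabs1).
by rewrite (le_lt_trans (vabs_exp_sub1 zr))// (lt_le_trans zr).
Qed.

(** exp x - exp y = (exp(x - y) - 1) exp y, and exp y has absolute value 1. *)
Lemma vabs_expB x y : vabs x < rho -> vabs y < rho ->
  vabs (padic_exp x - padic_exp y) <= vabs (x - y).
Proof.
move=> xr yr; have xyr : vabs (x - y) < rho.
  by rewrite (le_lt_trans (vabsD_max _ _))// gt_max vabsN xr.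
rewrite -{1}(subrK y x) padic_expD// -{2}(mul1r (padic_exp y)) -mulrBl vabsM.
by rewrite (vabs_exp yr) mulr1 vabs_exp_sub1.
Qed.

(** Each term of the series is at most |x - 1|, the size of the first. This keeps log q in the disc
    of convergence of exp. *)
Lemma vabs_log_le x : vabs (x - 1) < rho -> vabs (padic_log x) <= vabs (x - 1).
Proof.
move=> xr; set z := x - 1.
have term k :
    vabs ((-1) ^+ k * z ^+ k.+1 / k.+1%:R) <= vabs z * (vabs z / rho) ^+ k.
  exact: (vabs_log_term pp vp).
have th : 0 <= vabs z / rho < 1.
  by rewrite divr_ge0 ?vabs_ge0 ?(ltW rho_gt0)//= ltr_pdivrMr// mul1r.
apply: (@vabs_cvg_le _ _ (series (fun k => (-1) ^+ k * z ^+ k.+1 / k.+1%:R))).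
  apply: (@is_cvg_series_geometric _ _ _ (vabs z / rho)) => // k.
  rewrite (le_trans (term k))// ler_piMl ?exprn_ge0//; first by case/andP: th.
  by rewrite ltW// (lt_le_trans xr).
move=> n; apply: vabs_series_le; first exact: vabs_ge0.
move=> k; rewrite (le_trans (term k))// ler_piMr ?vabs_ge0//.
by rewrite exprn_ile1 ?(ltW (andP th).2)//; case/andP: th.
Qed.

End Exponential.

(** * Formal exponentials and the degenerate exponential *)

Section FormalExponential.
Context {R : realType} {K : nonArchFieldType R}.
Implicit Types (F : nat -> K) (lam z : K).

(** Low coefficients see only a truncation of F, so powers of series become powers of polynomials,
    where a derivative is at hand. *)
Lemma fps_pow_coef F N k m : (m < N)%N ->
  fps_pow F k m = ((\poly_(i < N) F i) ^+ k)`_m.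
Proof.
elim: k m => [|k ih] m mN; first by rewrite expr0 coef1.
rewrite exprS coefM /fps_pow iterS; apply: eq_bigr => i _.
rewrite coef_poly (leq_ltn_trans (leq_ord i) mN) -ih//.
exact: leq_ltn_trans (leq_subr _ _) mN.
Qed.

Lemma fps_exp_coef F N M m : F 0%N = 0 -> (m < N)%N -> (m < M)%N ->
  fps_exp F m = (\sum_(k < M) (k`!%:R)^-1 *: (\poly_(i < N) F i) ^+ k)`_m.
Proof.
move=> F0 mN mM; rewrite coef_sum /fps_exp.
rewrite (big_ord_widen M (fun k => fps_pow F k m / k`!%:R))// big_mkcond/=.
apply: eq_bigr => k _; rewrite coefZ mulrC -fps_pow_coef//.
case: ltnP => // mk; rewrite (fps_pow_coef _ _ mN); set f := \poly_(i < N) F i.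
(* As F has no constant term, X divides f, so f^k has no term of degree m < k: the sum may run up to
   any [M] beyond m. *)
have [g ->] : exists g, f = g * ('X - 0%:P).
  apply/factor_theorem; rewrite /root horner_coef0 coef_poly F0.
  by case: ifP.
by rewrite subr0 exprMn coefMXn mk mulr0.
Qed.

(** Differentiation sends f^k / k! to f' f^(k-1) / (k-1)!; read at degree m, this is (exp F)' = F'
    exp F. *)
Lemma fps_exp_deriv F m : (forall k, (0 < k)%N -> k%:R != 0 :> K) ->
  F 0%N = 0 ->
  m.+1%:R * fps_exp F m.+1 = fps_mul (fun i => i.+1%:R * F i.+1) (fps_exp F) m.
Proof.
move=> ch0 F0; set f := \poly_(i < m.+2) F i.
rewrite (@fps_exp_coef F m.+2 m.+2)// mulr_natl -coef_deriv -/f.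
have -> : (\sum_(k < m.+2) (k`!%:R)^-1 *: f ^+ k)^`() =
    f^`() * \sum_(k < m.+1) (k`!%:R)^-1 *: f ^+ k.
  rewrite big_ord_recl raddfD /= expr0 derivZ derivC scaler0 add0r.
  rewrite mulr_sumr raddf_sum; apply: eq_bigr => k _ /=.
  rewrite derivZ deriv_exp /= -scaler_nat scalerA -scalerAr; congr (_ *: _).
  rewrite factS natrM invfM mulrC mulrA mulfV ?mul1r//.
  exact: ch0.
rewrite coefM; apply: eq_bigr => i _.
rewrite -fps_exp_coef// ?ltnS ?leq_subr//; last by rewrite leqW// leq_subr.
by rewrite coef_deriv coef_poly !ltnS leq_ord mulr_natl.
Qed.

Lemma degenerate_fps_expE lam z n : (forall k, (0 < k)%N -> k%:R != 0 :> K) ->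
  lam != 0 -> n`!%:R * degenerate_fps_exp lam z n = degenerate_ffact lam z n.
Proof.
move=> ch0 lam0; set E := degenerate_fps_exp lam z.
(* The derivative of (z / lam) log(1 + lam t) is z / (1 + lam t), with coefficients z (- lam)^i. *)
have Erec m : m.+1%:R * E m.+1 = \sum_(i < m.+1) z * (- lam) ^+ i * E (m - i)%N.
  rewrite fps_exp_deriv ?mulr0// /fps_mul.
  apply: eq_bigr => i _; congr (_ * _).
  have i0 := ch0 i.+1 isT.
  rewrite /fps_log1p exprS [(- lam) ^+ i]exprNn; field.
  by rewrite lam0 nat1r i0.
(* The term i = 0 is z E_m; the others are - lam times the sum for m - 1, that is - lam m E_m. *)
have ES m : m.+1%:R * E m.+1 = (z - m%:R * lam) * E m.
  case: m => [|m]; first by rewrite Erec big_ord1 expr0 mulr1 mul0r subr0.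
  rewrite Erec big_ord_recl/= expr0 mulr1 subn0.
  under eq_bigr do rewrite subSS exprS mulrCA -mulrA.
  by rewrite -mulr_sumr -Erec; ring.
elim: n => [|n ih].
  rewrite /degenerate_ffact big_ord0 /E /degenerate_fps_exp /fps_exp.
  by rewrite big_ord1 fact0 /= divr1 mul1r.
rewrite /degenerate_ffact big_ord_recr/= -/(degenerate_ffact lam z n) -ih.
by rewrite factS natrM mulrAC ES; ring.
Qed.

End FormalExponential.

(** * Convergence of fermionic sums of polynomials in r^y *)

Section FermionicSums.
Context {R : realType} {K : nonArchFieldType R} (p : nat).
Hypotheses (pp : prime p) (vp : vabs (p%:R : K) = p%:R^-1).
Implicit Types (q r a : K) (P : {poly K}).

(** With s = r^(p^N), s^p - 1 is s - 1 times the sum of the s^i, i < p. That sum is p plus the terms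
    s^i - 1, hence of size at most c, so each p-th power gains a factor c. *)
Lemma vabs_expr_pow_sub1 (c : R) r N :
  vabs (p%:R : K) <= c -> vabs (r - 1) <= c -> c < 1 ->
  vabs (r ^+ (p ^ N) - 1) <= vabs (r - 1) * c ^+ N.
Proof.
move=> pc rc c1; have c0 : 0 <= c := le_trans (vabs_ge0 _) pc.
have near1 n : vabs (r ^+ n - 1) <= vabs (r - 1).
  rewrite -{1}(expr1n _ n) vabsBX_le ?vabs1//.
  by rewrite (vabs_near1_le vabs1)// (le_lt_trans rc).
elim: N => [|N ih]; first by rewrite expn0 !expr1 mulr1.
rewrite expnSr exprM subrX1; set s := r ^+ (p ^ N) in ih *.
rewrite exprSr mulrA vabsM_le//.
have -> : \sum_(i < p) s ^+ i = \sum_(i < p) (s ^+ i - 1) + p%:R.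
  by rewrite sumrB sumr_const card_ord subrK.
rewrite vabsD_le// vabs_sum_le// => i _.
by rewrite -exprM (le_trans (near1 _)).
Qed.

Lemma cvg_expr_pow r : vabs (r - 1) < 1 ->
  (fun N => r ^+ (p ^ N)) @ \oo --> (1 : K).
Proof.
move=> r1; pose c := Num.max (vabs (p%:R : K)) (vabs (r - 1)).
have c1 : c < 1 by rewrite gt_max r1 (vabs_p_lt1 pp vp).
have c0 : 0 <= c by rewrite le_max vabs_ge0.
have c01 : 0 <= c < 1 by rewrite c0.
apply: (cvg_vabs_le _ (cvg_geometric_seq (vabs (r - 1)) c01)) => N.
by rewrite vabs_expr_pow_sub1// le_max lexx ?orbT.
Qed.

Hypothesis podd : odd p.

(** 1 + a is close to 2, and |2| = 1 because p is odd. *)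
Lemma vabs_add1 a : vabs (a - 1) < 1 -> vabs (1 + a) = 1.
Proof.
move=> a1; apply: (@vabs_near1 _ _ 2).
  by rewrite (vabs_nat_coprime pp vp)// coprimen2.
by have -> : 1 + a - 2 = a - 1 by ring.
Qed.

Lemma add1_neq0 a : vabs (a - 1) < 1 -> 1 + a != 0.
Proof.
move=> /vabs_add1 a1; apply: contra_eq_neq a1 => ->.
by rewrite vabs0 eq_sym oner_eq0.
Qed.

Lemma vabs_mul_near1 a r :
  vabs (a - 1) < 1 -> vabs (r - 1) < 1 -> vabs (a * r - 1) < 1.
Proof.
move=> a1 r1; have -> : a * r - 1 = a * (r - 1) + (a - 1) by ring.
rewrite (le_lt_trans (vabsD_max _ _))// gt_max a1 andbT vabsM.
by rewrite (vabs_near1 vabs1 a1) mul1r.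
Qed.

Lemma vabs_expr_near1 r n : vabs (r - 1) < 1 -> vabs (r ^+ n - 1) < 1.
Proof.
move=> r1; elim: n => [|n ih]; first by rewrite expr0 subrr vabs0.
by rewrite exprS vabs_mul_near1.
Qed.

Lemma alternating_sum a N : vabs (a - 1) < 1 ->
  \sum_(0 <= y < p ^ N) (- a) ^+ y = (1 + a ^+ (p ^ N)) / (1 + a).
Proof.
move=> a1; apply: (mulIf (add1_neq0 a1)); rewrite divfK ?add1_neq0//.
have := subrX1 (- a) (p ^ N).
(* p^N is odd, so (- a)^(p^N) = - a^(p^N). *)
rewrite exprNn -signr_odd oddX podd orbT expr1 mulN1r -opprD -opprD mulNr.
by move=> /oppr_inj; rewrite big_mkord addrC => ->; rewrite addrC mulrC.
Qed.

Lemma is_cvg_fermionic_sum q r P (f : K -> K) :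
  vabs (q - 1) < 1 -> vabs (r - 1) < 1 -> (forall y, f y%:R = P.[r ^+ y]) ->
  cvgn (fermionic_sum p q f).
Proof.
move=> q1 r1 fP.
have a1 k : vabs (r ^+ k * q - 1) < 1.
  by rewrite vabs_mul_near1// vabs_expr_near1.
(* Expanding P and exchanging sums, the monomial of degree k contributes an alternating sum with a =
   r^k q. *)
have sumE N : fermionic_sum p q f N = ((1 + q ^+ (p ^ N)) / (1 + q))^-1 *
    \sum_(k < size P) P`_k / (1 + r ^+ k * q) * (1 + (r ^+ k * q) ^+ (p ^ N)).
  rewrite /fermionic_sum /qnum_neg; congr (_^-1 * _).
    by rewrite exprNn -signr_odd oddX podd orbT expr1 mulN1r opprK.
  under eq_bigr do rewrite fP horner_coef mulr_suml.
  rewrite exchange_big; apply: eq_bigr => k _ /=.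
  rewrite mulrAC -mulrA -alternating_sum// mulr_sumr; apply: eq_bigr => y _.
  by rewrite -mulrA -exprM mulnC exprM -exprMn mulrN.
have lim2 a : vabs (a - 1) < 1 ->
    (fun N => 1 + a ^+ (p ^ N)) @ \oo --> (1 + 1 : K).
  by move=> ?; apply: cvg_vabsD (cvg_expr_pow _) => //; exact: cvg_cst.
rewrite (funext sumE); apply: (@cvgP K _ (((1 + 1) / (1 + q))^-1 *
  \sum_(k < size P) P`_k / (1 + r ^+ k * q) * (1 + 1))).
apply: cvg_vabsM; last first.
  by apply: cvg_vabs_sum => k; apply: cvg_vabsMl; exact: lim2.
have v2 : vabs (1 + 1 : K) = 1 by rewrite vabs_add1// subrr vabs0.
have c2 : (1 + 1) / (1 + q) != 0.
  by rewrite mulf_neq0 ?invr_eq0 ?add1_neq0// subrr vabs0.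
(* 1 + q^(p^N) and 1 + 1 both have absolute value 1, so their quotients by 1 + q share one absolute
   value, as [cvg_vabsV] requires. *)
apply: (cvg_vabsV c2).
  by move=> n; rewrite !vabsM v2 vabs_add1// vabs_expr_near1.
under eq_fun do rewrite mulrC.
by rewrite mulrC; apply: cvg_vabsMl; exact: lim2.
Qed.

End FermionicSums.

(** * Continuity and integrability of polynomials in [x + y]_q *)

Lemma vabs_hornerB_le (R : realType) (K : nonArchFieldType R)
    (P : {poly K}) (a b : K) :
  vabs a <= 1 -> vabs b <= 1 ->
  vabs (P.[a] - P.[b]) <= (\sum_(k < size P) vabs P`_k) * vabs (a - b).
Proof.
move=> a1 b1; rewrite !horner_coef -sumrB.
have S0 : 0 <= \sum_(k < size P) vabs P`_k.
  by rewrite sumr_ge0// => k _; exact: vabs_ge0.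
rewrite vabs_sum_le ?mulr_ge0 ?vabs_ge0// => k _.
rewrite -mulrBr vabsM_le ?vabsBX_le//.
by rewrite (bigD1 k)//= lerDl sumr_ge0// => i _; exact: vabs_ge0.
Qed.

Lemma lipschitz_within_continuous (R : realType) (K : nonArchFieldType R)
    (D : set K) (f : K -> K) (c : R) : 0 <= c ->
  (forall y z, D y -> D z -> vabs (f y - f z) <= c * vabs (y - z)) ->
  {within D, continuous f}.
Proof.
move=> c0 lipf; apply/subspace_continuousP => y Dy.
apply/cvg_ballP => e e0; rewrite near_withinE.
(* Division is by c + 1, since c may be 0. *)
have c1 : 0 < c + 1 by rewrite ltr_wpDl.
have /nbhs_ballP[d d0 yd] : nbhs y (ball y (e / (c + 1))).
  by apply: nbhsx_ballx; rewrite divr_gt0.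
apply/nbhs_ballP; exists d => // z /yd yz Dz.
rewrite vabs_ballE (le_lt_trans (lipf _ _ Dy Dz))//.
rewrite vabs_ballE ltr_pdivlMr// in yz.
by rewrite (le_lt_trans _ yz)// mulrC ler_wpM2l ?vabs_ge0// lerDl.
Qed.

Section FermionicIntegral.
Context {R : realType} {K : nonArchFieldType R} (p : nat).
Hypotheses (pp : prime p) (podd : odd p) (Kp : is_Cp p K).

Let vp := Cp_vabs_p Kp.
Let cK := Cp_complete Kp.
Let rho : R := p%:R `^ (- (p.-1%:R)^-1).

(** Continuity comes from a Lipschitz bound, exp being 1-Lipschitz on its disc; convergence comes
    from exp(n L) = (exp L)^n at natural numbers n. *)
Lemma fermionic_integrable_exp_poly (q L : K) (P : {poly K}) (f : K -> K) :
  vabs (q - 1) < 1 -> vabs L < rho ->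
  (forall y, vabs y <= 1 -> f y = P.[padic_exp (y * L)]) ->
  fermionic_integrable p q f.
Proof.
move=> q1 Lr fP.
have yL y : vabs y <= 1 -> vabs (y * L) < rho.
  by move=> y1; rewrite (le_lt_trans _ Lr)// vabsM ler_piMl ?vabs_ge0.
have S0 : 0 <= \sum_(k < size P) vabs P`_k.
  by rewrite sumr_ge0// => k _; exact: vabs_ge0.
split.
  apply: (lipschitz_within_continuous S0) => y z [_ y1] [_ z1].
  rewrite !fP// (le_trans (vabs_hornerB_le _ _ _))
    ?(vabs_exp pp vp cK (yL _ _))//.
  rewrite ler_wpM2l// (le_trans (vabs_expB pp vp cK (yL _ y1) (yL _ z1)))//.
  rewrite -mulrBl vabsM ler_piMr ?vabs_ge0// ltW// (lt_le_trans Lr)//.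
  exact: (padic_radius_le1 pp vp).
have r1 : vabs (padic_exp L - 1) < 1.
  rewrite (le_lt_trans (vabs_exp_sub1 pp vp cK Lr))// (lt_le_trans Lr)//.
  exact: (padic_radius_le1 pp vp).
have expL n : padic_exp (n.+1%:R * L) = padic_exp L ^+ n.+1.
  elim: n => [|n ih]; first by rewrite mul1r.
  rewrite -natr1 mulrDl mul1r (padic_expD pp vp cK) ?ih -?exprSr//.
  exact/yL/vabs_nat_le1.
have exp0 : padic_exp 0 = 1 :> K.
  have r0 : vabs (0 : K) < rho by rewrite vabs0 (padic_radius_gt0 pp).
  have := vabs_exp_sub1 pp vp cK r0; rewrite vabs0 => e0.
  apply/eqP; rewrite -subr_eq0; apply/eqP/vabs_eq0/eqP.
  by rewrite eq_le e0 vabs_ge0.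
apply: (is_cvg_fermionic_sum pp vp podd q1 r1) => y.
rewrite fP ?vabs_nat_le1//; congr (P.[_]).
by case: y => [|y]; rewrite ?mul0r ?exp0 ?expL.
Qed.

Lemma fermionic_integralZ (q c : K) (f : K -> K) :
  cvgn (fermionic_sum p q f) ->
  fermionic_integral p q (fun y => c * f y) = c * fermionic_integral p q f.
Proof.
move=> cf; apply: cvg_vabs_lim.
rewrite (_ : fermionic_sum _ _ _ = fun N => c * fermionic_sum p q f N).
  exact: cvg_vabsMl.
apply/funext => N.
rewrite /fermionic_sum mulrCA; congr (_ * _); rewrite mulr_sumr.
by apply: eq_bigr => y _; rewrite mulrA.
Qed.

Lemma fermionic_integrable_qnum_poly (q x : K) (P : {poly K}) :
  vabs (q - 1) < rho -> vabs x <= 1 ->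
  fermionic_integrable p q (fun y => P.[qnum q (x + y)]).
Proof.
move=> qr x1; have Lr : vabs (padic_log q) < rho.
  exact: le_lt_trans (vabs_log_le pp vp cK qr) qr.
(* [x + y]_q is the affine function [Q] of exp(y log q). *)
pose Q : {poly K} := (1 - q)^-1 *: (1 - padic_exp (x * padic_log q) *: 'X).
have yL y : vabs y <= 1 -> vabs (y * padic_log q) < rho.
  by move=> y1; rewrite (le_lt_trans _ Lr)// vabsM ler_piMl ?vabs_ge0.
apply: (@fermionic_integrable_exp_poly _ (padic_log q) (P \Po Q)) => //.
  by rewrite (lt_le_trans qr)// (padic_radius_le1 pp vp).
move=> y y1; rewrite horner_comp; congr (P.[_]).
rewrite /qnum /qpow (mulrDl x y) (padic_expD pp vp cK) ?yL//.
by rewrite /Q !hornerE mulrC.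
Qed.

End FermionicIntegral.

Theorem theorem2p3 (p : nat) (R : realType) (Cp : nonArchFieldType R)
    (hp : prime p) (hodd : odd p) (hCp : is_Cp p Cp)
    (q lam x : Cp)
    (hq1 : q <> 1)
    (hq : vabs (q - 1) < (p%:R : R) `^ (- (p.-1%:R)^-1))
    (hlam : lam <> 0)
    (hx : vabs x <= 1)
    (n : nat) :
  fermionic_integrable p q (fun y => degenerate_ffact lam (qnum q (x + y)) n)
  /\ fermionic_integral p q (fun y => degenerate_ffact lam (qnum q (x + y)) n)
     = degenerate_qEuler p q x lam n.
Proof.
have ch0 k : (0 < k)%N -> k%:R != 0 :> Cp.
  exact: natf_neq0_padic hp (Cp_vabs_p hCp) k.
have lam0 : lam != 0 by apply/eqP.
(* Both integrands are polynomials in [x + y]_q: [P] for the falling factorial, and P / n! for the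
   series coefficient. *)
pose P : {poly Cp} := \prod_(i < n) ('X - (i%:R * lam)%:P).
have ffactP z : degenerate_ffact lam z n = P.[z].
  by rewrite horner_prod; apply: eq_bigr => i _; rewrite !hornerE.
have fps_expP z : degenerate_fps_exp lam z n = ((n`!%:R)^-1 *: P).[z].
  rewrite hornerZ -ffactP -degenerate_fps_expE// mulKf//.
  by rewrite ch0// fact_gt0.
split.
  under eq_fun do rewrite ffactP.
  exact: fermionic_integrable_qnum_poly.
(* Moving n! inside the integral reduces the claim to equality of the integrands and convergence of
   the sums for the series coefficient. *)
rewrite /degenerate_qEuler /degenerate_qEuler_series -fermionic_integralZ.
  by congr fermionic_integral; apply/funext => y; rewrite degenerate_fps_expE.
under eq_fun do rewrite fps_expP.
by have [] :=
  fermionic_integrable_qnum_poly hp hodd hCp ((n`!%:R)^-1 *: P) hq hx.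
Qed.
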